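(* For a covering problem $C$ of cardinality $k\ge2$, let $\mathrm{NE}^{\rm alg}(C)$ be the set of allocations to which the asynchronous cardinality learning algorithm (described in the context) converges on $C$, and let $G^\star=\{C,f^\star_k\}$ be the associated covering game with distribution rule $f^\star_k$. (i) There exists a covering problem $C$ such that $$\min_{a\in\mathrm{NE}^{\rm alg}(C)}W(a)>\min_{a\in\mathrm{NE}(G^\star)}W(a).$$ (ii) There exists a covering problem $C$ such that $$\min_{a\in\mathrm{NE}^{\rm alg}(C)}W(a)<\min_{a\in\mathrm{NE}(G^\star)}W(a).$$
   Context: Notation: $[p]=\{1,\dots,p\}$. Covering problem: $C=\{N,\mathcal{R},\{\mathcal{A}^i\}_{i\in N},\{v_r\}_{r\in\mathcal{R}}\}$ consists of a finite set of agents $N=\{1,\dots,n\}$, a finite set of resources $\mathcal{R}$, non-empty action sets $\mathcal{A}^i\subseteq 2^{\mathcal{R}}$, and values $v_r\ge 0$. An allocation is $a=(a^1,\dots,a^n)\in\mathcal{A}=\mathcal{A}^1\times\dots\times\mathcal{A}^n$; $|a|_r$ is the number of agents $i$ with $r\in a^i$. The welfare is $W(a)=\sum_{r:\,|a|_r\ge1}v_r$. The cardinality of $C$ is $\max_{r\in\mathcal{R},\,a\in\mathcal{A}}|a|_r$. Covering game: given $C$ of cardinality $k$ and $f:[k]\to\mathbb{R}_{\ge0}$, the game $G=\{C,f\}$ has utilities $u^i(a^i,a^{-i})=\sum_{r\in a^i}v_r f(|a|_r)$, and $\mathrm{NE}(G)$ is the set of pure Nash equilibria, i.e. allocations $a_e$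 with $u^i(a_e^i,a_e^{-i})\ge u^i(a^i,a_e^{-i})$ for all $i\in N$, $a^i\in\mathcal{A}^i$. Rules: for an integer $\ell\ge2$, $f^\star_\ell:[\ell]\to\mathbb{R}_{\ge0}$ is $$f^\star_\ell(j)=(j-1)!\,\frac{\frac{1}{(\ell-1)(\ell-1)!}+\sum_{i=j}^{\ell-1}\frac{1}{i!}}{\frac{1}{(\ell-1)(\ell-1)!}+\sum_{i=1}^{\ell-1}\frac{1}{i!}},\quad j\in[\ell],$$ and $f^\star_1(1)=1$. For $\ell\in[n]$, $f^{\rm alg}_\ell:[n]\to\mathbb{R}_{\ge0}$ is $f^{\rm alg}_\ell(j)=f^\star_\ell(j)$ for $j\le\ell$ and $f^{\rm alg}_\ell(j)=f^\star_\ell(\ell)$ for $\ell<j\le n$. Asynchronous cardinality learning algorithm: start from $a_0\in\mathcal{A}$ and set $x_r(0)=\max\{1,|a_0|_r\}$ for all $r\in\mathcal{R}$. At each time $t=0,1,2,\dots$, let $i=1+(t \bmod n)$; agent $i$ best responds, i.e. $$a^i_{t+1}\in\arg\max_{a^i\in\mathcal{A}^i}\ \sum_{r\in a^i}v_r\, f^{\rm alg}_{x_r(t)}\bigl(|(a^i,a_t^{-i})|_r\bigr),$$ where ties are broken by selecting the maximiser that is ranked highest in a fixed strict linear order on $\mathcal{A}^i$; the other agents keep their actions, so $a_{t+1}=(a^i_{t+1},a^{-i}_t)$. Then $x_r(t+1)=\max\{x_r(t),|a_{t+1}|_r\}$ for all $r\in\mathcal{R}$. The sequence $(a_t)_t$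 is eventually constant; $\mathrm{NE}^{\rm alg}(C)$ is the set of all limits $\lim_{t\to\infty}a_t$ obtained over all initial allocations $a_0\in\mathcal{A}$ and all choices of the tie-breaking orders. *)

(* Defs.v *)
From HB Require Import structures.
From mathcomp Require Import all_boot all_order all_algebra.
From mathcomp Require Import classical_sets reals.

Set Implicit Arguments.
Unset Strict Implicit.
Unset Printing Implicit Defensive.

Import Order.TTheory GRing.Theory Num.Theory.
Local Open Scope ring_scope.

(* Agents are numbered from 0: agent [i : 'I_agents] is the agent i + 1 of
   the set {1, ..., n}. *)
Record covering_problem (R : realType) := CoveringProblem {
  agents : nat;
  resource : finType;
  actions : 'I_agents -> {set {set resource}};
  actions_neq0 : forall i, actions i != finset.set0;
  value : resource -> R;
  value_ge0 : forall r, 0 <= value r }.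

Arguments actions {R} c i.

(* Profiles are arbitrary; the allocations are those that are [feasible]. *)
Definition profile (R : realType) (C : covering_problem R) :=
  {ffun 'I_(agents C) -> {set resource C}}.

Definition feasible (R : realType) (C : covering_problem R) (a : profile C) :=
  [forall i, a i \in actions C i].

Definition load (R : realType) (C : covering_problem R) (a : profile C)
    (r : resource C) : nat :=
  #|[pred i | r \in a i]|.

Definition welfare (R : realType) (C : covering_problem R) (a : profile C) : R :=
  \sum_(r | (1 <= load a r)%N) value r.

Definition cardinality (R : realType) (C : covering_problem R) : nat :=
  \max_(a : profile C | feasible a) \max_(r : resource C) load a r.

Definition deviate (R : realType) (C : covering_problem R) (a : profile C)
    (i : 'I_(agents C)) (b : {set resource C}) : profile C :=
  [ffun j => if j == i then b else a j].

(* The rule may depend on the resource, which the learning algorithm needs;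
   in a covering game it does not. Rules are total functions on [nat], only
   ever evaluated at positive loads. *)
Definition utility (R : realType) (C : covering_problem R)
    (f : resource C -> nat -> R) (i : 'I_(agents C)) (a : profile C) : R :=
  \sum_(r in a i) value r * f r (load a r).

Definition NE (R : realType) (C : covering_problem R) (f : nat -> R) :
    set (profile C) :=
  fun a => feasible a /\
    forall (i : 'I_(agents C)) (b : {set resource C}), b \in actions C i ->
      utility (fun=> f) i (deviate a i b) <= utility (fun=> f) i a.

(* Meaningful for 1 <= l and 1 <= j <= l. *)
Definition fstar (R : realType) (l j : nat) : R :=
  if l == 1%N then 1 else
  let c : R := ((l.-1)%:R * (l.-1)`!%:R)^-1 in
  (j.-1)`!%:R * ((c + \sum_(j <= i < l) (i`!%:R)^-1) /
                 (c + \sum_(1 <= i < l) (i`!%:R)^-1)).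

Definition falg (R : realType) (l j : nat) : R :=
  if (j <= l)%N then fstar R l j else fstar R l l.

Definition strict_linear_on (T : finType) (A : {set T}) (lt : rel T) : Prop :=
  [/\ {in A, forall b, ~~ lt b b},
      {in A & A & A, forall b c d, lt b c -> lt c d -> lt b d}
    & {in A &, forall b c, b != c -> lt b c || lt c b}].

Definition is_maximiser (R : realType) (T : finType) (A : {set T}) (g : T -> R)
    (b : T) : Prop :=
  b \in A /\ {in A, forall c, g c <= g b}.

(* [lt c b] reads "b is ranked higher than c". *)
Definition is_selected (R : realType) (T : finType) (A : {set T}) (lt : rel T)
    (g : T -> R) (b : T) : Prop :=
  is_maximiser A g b /\ forall c, is_maximiser A g c -> c != b -> lt c b.

(* [estimate a t r] is x_r(t) along the sequence of profiles [a]. *)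
Fixpoint estimate (R : realType) (C : covering_problem R) (a : nat -> profile C)
    (t : nat) (r : resource C) : nat :=
  match t with
  | 0 => maxn 1 (load (a 0%N) r)
  | s.+1 => maxn (estimate a s r) (load (a s.+1) r)
  end.

(* With agents numbered from 0, the agent who moves at time t is t mod n. *)
Definition alg_run (R : realType) (C : covering_problem R)
    (lt : 'I_(agents C) -> rel {set resource C}) (a : nat -> profile C) : Prop :=
  feasible (a 0%N) /\
  forall (t : nat) (i : 'I_(agents C)), nat_of_ord i = (t %% agents C)%N ->
    is_selected (actions C i) (lt i)
      (fun b => utility (fun r => falg R (estimate a t r)) i (deviate (a t) i b))
      (a t.+1 i)
    /\ forall j, j != i -> a t.+1 j = a t j.

Definition NEalg (R : realType) (C : covering_problem R) : set (profile C) :=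
  fun b => exists (lt : 'I_(agents C) -> rel {set resource C})
                  (a : nat -> profile C),
    [/\ forall i, strict_linear_on (actions C i) (lt i),
        alg_run lt a
      & exists T, forall t, (T <= t)%N -> a t = b].

Definition is_min (R : realType) (E : set R) (m : R) : Prop :=
  E m /\ lbound E m.

(* Main.v *)
Require Import Defs.
From mathcomp Require Import all_boot all_order all_algebra.
From mathcomp Require Import classical_sets reals.
From mathcomp Require Import ring lra.

Set Implicit Arguments.
Unset Strict Implicit.
Unset Printing Implicit Defensive.

Import Order.TTheory GRing.Theory Num.Theory.
Local Open Scope ring_scope.

(* Three agents play on the resources [bool * bool]. Agent 0 alone has a choice:
   the resources with first component [true], of which (true, true) is shared
   with agent 1, or those with first component [false], of which (false, true)
   is shared with agents 1 and 2. Hence the cardinality is 3, and agent 0 gets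
   the shares f(2) = 3/7 of (true, true) and f(3) = 2/7 of (false, true) under
   f = fstar 3. The algorithm never sees a load above 2 on (true, true), which
   is therefore worth at least the share 1/2 given by the rule for 2. When the
   values lie between the two thresholds 3/7 and 1/2, the only equilibrium is
   on the side [false] and the only limit of the algorithm is on the side
   [true]. The difference of the welfares is that of the unshared resources,
   whose sign is still free. *)

(** * Values of the distribution rules at small loads *)

Lemma fstar31 (R : realType) : fstar R 3 1 = 1.
Proof. by rewrite /fstar /= !big_cons !big_nil /= !factS fact0 !muln1; field. Qed.

Lemma fstar32 (R : realType) : fstar R 3 2 = 3 / 7.
Proof. by rewrite /fstar /= !big_cons !big_nil /= !factS fact0 !muln1; field. Qed.

Lemma fstar33 (R : realType) : fstar R 3 3 = 2 / 7.
Proof. by rewrite /fstar /= !big_cons !big_nil /= !factS fact0 !muln1; field. Qed.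

Lemma falg1 (R : realType) (j : nat) : falg R 1 j = 1.
Proof. by rewrite /falg /fstar; case: ifP. Qed.

Lemma falg22 (R : realType) : falg R 2 2 = 1 / 2.
Proof. by rewrite /falg /fstar /= !big_cons !big_nil /= !factS fact0 !muln1; field. Qed.

Lemma falg33 (R : realType) : falg R 3 3 = 2 / 7.
Proof. exact: fstar33. Qed.

Lemma bigsum_bool2 (V : nmodType) (F : bool * bool -> V) :
  \sum_x F x =
  F (true, true) + F (true, false) + F (false, true) + F (false, false).
Proof.
rewrite (eq_bigr (fun x => F (x.1, x.2))) => [|[] //].
by rewrite -(pair_bigA _ (fun x y => F (x, y))) !big_bool /= addrA.
Qed.

(** * The family of covering problems, with free values *)

Definition side (b : bool) : {set bool * bool} := [set x | x.1 == b].

Definition alloc_set (b : bool) (i : 'I_3) : {set bool * bool} :=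
  match nat_of_ord i with
  | 0 => side b
  | 1 => [set x | x.2]
  | _ => [set x | ~~ x.1 && x.2]
  end.

(** For agents 1 and 2 the two members coincide, which leaves them a single action. *)
Definition mover_actions (i : 'I_3) : {set {set bool * bool}} :=
  [set alloc_set true i; alloc_set false i].

Lemma mover_actions_neq0 (i : 'I_3) : mover_actions i != finset.set0.
Proof. by apply/set0Pn; exists (alloc_set true i); rewrite !inE eqxx. Qed.

Definition mover_problem (R : realType) (v : bool * bool -> R)
    (v_ge0 : forall x, 0 <= v x) : covering_problem R :=
  CoveringProblem mover_actions_neq0 v_ge0.

Definition alloc (b : bool) : {ffun 'I_3 -> {set bool * bool}} :=
  [ffun i => alloc_set b i].

Lemma alloc_set_fixed (b c : bool) (i : 'I_3) :
  i != ord0 -> alloc_set b i = alloc_set c i.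
Proof. by case: i => [[|[|[|]]] ?]. Qed.

Lemma loadE (R : realType) (v : bool * bool -> R) (v_ge0 : forall x, 0 <= v x)
    (a : profile (mover_problem v_ge0)) (x : bool * bool) :
  load a x = ((x \in a ord0) + (x \in a (lift ord0 ord0))
              + (x \in a (lift ord0 (lift ord0 ord0))))%N.
Proof.
rewrite /load -sum1_card big_mkcond /= !big_ord_recl big_ord0 /= !inE addn0 addnA.
by do 3 case: (_ \in _).
Qed.

Lemma load_alloc (R : realType) (v : bool * bool -> R)
    (v_ge0 : forall x, 0 <= v x) (b : bool) (x : bool * bool) :
  load (alloc b : profile (mover_problem v_ge0)) x =
  ((x.1 == b) + x.2 + (~~ x.1 && x.2))%N.
Proof. by rewrite loadE !ffunE /alloc_set /= !inE. Qed.

Lemma feasibleP (R : realType) (v : bool * bool -> R)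
    (v_ge0 : forall x, 0 <= v x) (a : profile (mover_problem v_ge0)) :
  reflect (exists b, a = alloc b) (feasible a).
Proof.
apply: (iffP forallP) => [fa | [b ->] i]; last first.
  by rewrite !inE ffunE; case: b; rewrite eqxx ?orbT.
have [b a0_eq] : exists b, a ord0 = side b.
  by have := fa ord0; rewrite !inE => /orP[] /eqP ->; [exists true | exists false].
exists b; apply/ffunP => i; rewrite ffunE.
have [-> // | i_neq0] := eqVneq i ord0.
have := fa i; rewrite !inE.
by rewrite (alloc_set_fixed true b i_neq0) (alloc_set_fixed false b i_neq0) orbb => /eqP.
Qed.

Lemma deviate_alloc (R : realType) (v : bool * bool -> R)
    (v_ge0 : forall x, 0 <= v x) (b c : bool) :
  deviate (alloc b : profile (mover_problem v_ge0)) ord0 (side c) = alloc c.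
Proof.
apply/ffunP => i; rewrite !ffunE.
by have [-> // | i_neq0] := eqVneq i ord0; apply: alloc_set_fixed.
Qed.

(** A rule [f] that depends on the resource serves both the game and the algorithm. *)
Lemma utility_alloc (R : realType) (v : bool * bool -> R)
    (v_ge0 : forall x, 0 <= v x) (f : bool * bool -> nat -> R) (b : bool) :
  utility (C := mover_problem v_ge0) f ord0 (alloc b) =
  v (b, true) * f (b, true) (if b then 2%N else 3%N)
  + v (b, false) * f (b, false) 1%N.
Proof.
rewrite /utility big_mkcond bigsum_bool2 !load_alloc ffunE !inE.
by case: b => /=; rewrite ?(addr0, add0r).
Qed.

Lemma welfare_alloc (R : realType) (v : bool * bool -> R)
    (v_ge0 : forall x, 0 <= v x) (b : bool) :
  welfare (alloc b : profile (mover_problem v_ge0)) =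
  v (true, true) + v (false, true) + v (b, false).
Proof.
rewrite /welfare big_mkcond bigsum_bool2 !load_alloc.
by case: b => /=; rewrite ?(addr0, add0r) // addrAC.
Qed.

Lemma cardinality_mover (R : realType) (v : bool * bool -> R)
    (v_ge0 : forall x, 0 <= v x) : cardinality (mover_problem v_ge0) = 3%N.
Proof.
apply/eqP; rewrite eqn_leq; apply/andP; split.
  apply/bigmax_leqP => a _; apply/bigmax_leqP => x _.
  by rewrite loadE; do 3 case: (_ \in _).
(* All three agents meet on [(false, true)] here, so the bound 3 is attained. *)
have fa : feasible (alloc false : profile (mover_problem v_ge0)).
  by apply/feasibleP; exists false.
apply: leq_trans (leq_bigmax_cond _ fa).
apply: leq_trans (leq_bigmax (false, true)).
by rewrite load_alloc.
Qed.

(** * Equilibria of the covering game *)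

Lemma NE_mover (R : realType) (v : bool * bool -> R)
    (v_ge0 : forall x, 0 <= v x) :
  v (true, true) * (3 / 7) + v (true, false)
    < v (false, true) * (2 / 7) + v (false, false) ->
  NE (C := mover_problem v_ge0) (fstar R 3) = [set alloc false]%classic.
Proof.
move=> lt_star; apply/seteqP; split=> [a [/feasibleP[b ->]] | a ->].
  move/(_ ord0 (side false)); rewrite !inE eqxx orbT deviate_alloc !utility_alloc.
  case: b => // /(_ isT); rewrite fstar32 fstar33 fstar31; lra.
split=> [|i c]; first by apply/feasibleP; exists false.
have [-> | i_neq0] := eqVneq i ord0.
  rewrite !inE => /orP[] /eqP ->; rewrite deviate_alloc !utility_alloc //.
  rewrite fstar32 fstar33 fstar31; lra.
(* Agents 1 and 2 can only deviate to their current action. *)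
rewrite !inE (alloc_set_fixed true false i_neq0) orbb => /eqP ->.
rewrite [deviate _ _ _](_ : _ = (alloc false : profile (mover_problem v_ge0))) //.
by apply/ffunP => j; rewrite !ffunE; case: eqP => // ->.
Qed.

(** * Limits of the learning algorithm *)

Lemma estimate_ge (R : realType) (C : covering_problem R) (a : nat -> profile C)
    (t : nat) (r : resource C) : (maxn 1 (load (a t) r) <= estimate a t r)%N.
Proof.
rewrite geq_max; apply/andP; split; last by case: t => *; apply: leq_maxr.
by elim: t => [|t IHt]; rewrite /= leq_max ?IHt.
Qed.

Lemma estimate_le (R : realType) (C : covering_problem R) (a : nat -> profile C)
    (m : nat) (r : resource C) :
  (0 < m)%N -> (forall t, (load (a t) r <= m)%N) ->
  forall t, (estimate a t r <= m)%N.
Proof.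
by move=> m_gt0 le_m; elim=> [|t IHt] /=; rewrite geq_max le_m ?m_gt0 ?IHt.
Qed.

Lemma alg_run_feasible (R : realType) (C : covering_problem R)
    (lt : 'I_(agents C) -> rel {set resource C}) (a : nat -> profile C) :
  alg_run lt a -> forall t, feasible (a t).
Proof.
move=> [fa0 step]; elim=> [//|t /forallP IHt]; apply/forallP => i.
have n_gt0 : (0 < agents C)%N by case: (agents C) i => // -[].
have [sel stay] := step t (Ordinal (ltn_pmod t n_gt0)) erefl.
have [-> | /stay -> //] := eqVneq i (Ordinal (ltn_pmod t n_gt0)).
by case: sel => -[].
Qed.

(** Without ties the order [lt] is never consulted. *)
Lemma strict_max_selected (R : realType) (T : finType) (A : {set T})
    (lt : rel T) (g : T -> R) (b : T) :
  b \in A -> {in A, forall c, c != b -> g c < g b} -> is_selected A lt g b.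
Proof.
move=> bA max_b; split=> [|c [cA max_c] c_neq_b].
  by split=> // c cA; have [-> // | /(max_b _ cA)/ltW] := eqVneq c b.
by have := max_b c cA c_neq_b; rewrite ltNge max_c.
Qed.

Lemma strict_linear_enum_rank (T : finType) (A : {set T}) :
  strict_linear_on A (fun b c => (enum_rank b < enum_rank c)%N).
Proof.
split=> [b _ | b c d _ _ _ | b c _ _]; first by rewrite ltnn.
  exact: ltn_trans.
by rewrite -neq_ltn; apply: contraNneq => /ord_inj/enum_rank_inj ->.
Qed.

(** The estimate on [(true, true)] is 1 or 2, so the share there is 1 or 1/2; the value being
    nonnegative, 1/2 is the worst case. *)
Lemma utility_side_lt (R : realType) (v : bool * bool -> R)
    (v_ge0 : forall x, 0 <= v x) (x : bool * bool -> nat) :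
  v (false, true) * (2 / 7) + v (false, false)
    < v (true, true) * (1 / 2) + v (true, false) ->
  (0 < x (true, true) <= 2)%N -> x (false, true) = 3%N ->
  (forall b, x (b, false) = 1%N) ->
  utility (C := mover_problem v_ge0) (fun r => falg R (x r)) ord0 (alloc false)
    < utility (C := mover_problem v_ge0) (fun r => falg R (x r)) ord0 (alloc true).
Proof.
move=> lt_alg x_tt x_ft x_false; rewrite !utility_alloc x_ft !x_false falg33 !falg1.
have := v_ge0 (true, true).
by case: (x (true, true)) x_tt => [|[|[|]]] // _; rewrite ?falg1 ?falg22; lra.
Qed.

(** Once the load 3 on [(false, true)] has been recorded, the bounds on the loads of feasible
    profiles pin down all that agent 0 needs. *)
Lemma estimate_mover (R : realType) (v : bool * bool -> R)
    (v_ge0 : forall x, 0 <= v x) (a : nat -> profile (mover_problem v_ge0))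
    (t : nat) :
  (forall s, feasible (a s)) -> (3 <= estimate a t (false, true))%N ->
  [/\ (0 < estimate a t (true, true) <= 2)%N,
      estimate a t (false, true) = 3%N
    & forall b, estimate a t (b, false) = 1%N].
Proof.
move=> fa ge3.
have gt0 r : (0 < estimate a t r)%N.
  by apply: leq_trans (estimate_ge a t r); rewrite leq_maxl.
split=> [||b]; rewrite ?gt0 /=; [|apply/eqP; rewrite eqn_leq ge3 andbT
  |apply/eqP; rewrite eqn_leq gt0 andbT];
  apply: estimate_le => // s; have /feasibleP[c ->] := fa s;
  by rewrite load_alloc; case: c => //; case: b.
Qed.

Lemma NEalg_mover (R : realType) (v : bool * bool -> R)
    (v_ge0 : forall x, 0 <= v x) :
  v (false, true) * (2 / 7) + v (false, false)
    < v (true, true) * (1 / 2) + v (true, false) ->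
  @NEalg R (mover_problem v_ge0) = [set alloc true]%classic.
Proof.
move=> lt_alg; apply/seteqP; split=> [c [lt [a [_ run [T lim]]]] | c ->].
  have fa := alg_run_feasible run.
  have /feasibleP[[|] c_eq] : feasible c by rewrite -(lim T).
    by [].
  (* At time [T * 3] the run has settled and agent 0 moves, so its limit action must be a best
     response. On the side [false] it is not, since the limit itself has load 3 on
     [(false, true)]. *)
  have T_le : (T <= T * 3)%N by rewrite leq_pmulr.
  have [[[_ max_false] _] _] := run.2 _ _ (esym (modnMl T 3) : nat_of_ord (ord0 : 'I_3) = _).
  have := max_false (side true); rewrite !inE eqxx => /(_ isT).
  rewrite !lim ?(leqW T_le) // c_eq ffunE !deviate_alloc leNgt => /negP[].
  have [|? ? ?] := @estimate_mover _ _ _ a (T * 3) fa.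
    apply: leq_trans (estimate_ge _ _ _).
    by rewrite lim // c_eq load_alloc.
  exact: utility_side_lt.
(* Starting on the side [false] records the load 3 on (false, true), so that
   agent 0 never returns there. *)
pose a t : profile (mover_problem v_ge0) := alloc (0 < t)%N.
have fa t : feasible (a t) by apply/feasibleP; exists (0 < t)%N.
have ge3 t : (3 <= estimate a t (false, true))%N.
  apply: (@leq_trans (estimate a 0 (false, true))).
    by rewrite /= load_alloc.
  by elim: t => // t IHt; rewrite /= leq_max IHt.
exists (fun _ b c => (enum_rank b < enum_rank c)%N), a; split.
- by move=> i; apply: strict_linear_enum_rank.
- split=> // t i i_eq; split=> [|j j_neq_i].
    apply: strict_max_selected => [|b].
      by rewrite ffunE !inE eqxx.
    have [-> | i_neq0] := eqVneq i ord0.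
      rewrite ffunE !inE => /orP[] /eqP ->; first by rewrite eqxx.
      rewrite !deviate_alloc => _.
      have [? ? ?] := estimate_mover fa (ge3 t).
      exact: utility_side_lt.
    by rewrite ffunE !inE (alloc_set_fixed false true i_neq0) orbb => ->.
  (* The profile changes only at time 0, when agent 0 moves. *)
  case: t i_eq => [|//] i_eq; rewrite !ffunE; apply: alloc_set_fixed.
  by rewrite -(_ : i = ord0) //; apply/val_inj.
- by exists 1%N => -[].
Qed.

Lemma is_min_image1 (R : realType) (T : Type) (f : T -> R) (x : T) :
  is_min (f @` [set x])%classic (f x).
Proof. by split=> [|_ [_ -> <-]] //; exists x. Qed.

(** Both sets of outcomes are singletons, so each minimum is the welfare of one allocation. *)
Lemma mover_minima (R : realType) (v : bool * bool -> R)
    (v_ge0 : forall x, 0 <= v x) (C := mover_problem v_ge0) :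
  v (true, true) * (3 / 7) + v (true, false)
    < v (false, true) * (2 / 7) + v (false, false) ->
  v (false, true) * (2 / 7) + v (false, false)
    < v (true, true) * (1 / 2) + v (true, false) ->
  is_min (image (@NEalg R C) (@welfare R C))
    (v (true, true) + v (false, true) + v (true, false)) /\
  is_min (image (NE (C := C) (fstar R (cardinality C))) (@welfare R C))
    (v (true, true) + v (false, true) + v (false, false)).
Proof.
move=> lt_star lt_alg; rewrite cardinality_mover NE_mover // NEalg_mover //.
by rewrite -!(welfare_alloc v_ge0); split; apply: is_min_image1.
Qed.

(** Natural values are nonnegative for free. Taking [tt] to be 28, a multiple of 7 and of 2, turns
    the shares 3/7 and 1/2 into 12 and 14. *)
Definition weights (R : realType) (tt tf ft ff : nat) (x : bool * bool) : R :=
  (if x.1 then if x.2 then tt else tf else if x.2 then ft else ff)%:R.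

Lemma weights_ge0 (R : realType) (tt tf ft ff : nat) (x : bool * bool) :
  0 <= weights R tt tf ft ff x.
Proof. exact: ler0n. Qed.

Theorem theorem3 (R : realType) :
  (exists C : covering_problem R,
     (2 <= cardinality C)%N /\
     exists m_alg m_star : R,
       [/\ is_min (image (@NEalg R C) (@welfare R C)) m_alg,
           is_min (image (NE (C := C) (fstar R (cardinality C))) (@welfare R C))
             m_star
         & m_alg > m_star])
  /\
  (exists C : covering_problem R,
     (2 <= cardinality C)%N /\
     exists m_alg m_star : R,
       [/\ is_min (image (@NEalg R C) (@welfare R C)) m_alg,
           is_min (image (NE (C := C) (fstar R (cardinality C))) (@welfare R C))
             m_star
         & m_alg < m_star]).
Proof.
split.
- (* 12 + 1 < 14 < 14 + 1 *)
  have [||min_alg min_star] := mover_minima (weights_ge0 R 28 1 49 0).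
  1,2: by rewrite /weights /=; lra.
  exists (mover_problem (weights_ge0 R 28 1 49 0)); split.
    by rewrite cardinality_mover.
  by do 2 eexists; split; [exact: min_alg | exact: min_star | rewrite /weights /=; lra].
- (* 12 < 13 < 14 *)
  have [||min_alg min_star] := mover_minima (weights_ge0 R 28 0 0 13).
  1,2: by rewrite /weights /=; lra.
  exists (mover_problem (weights_ge0 R 28 0 0 13)); split.
    by rewrite cardinality_mover.
  by do 2 eexists; split; [exact: min_alg | exact: min_star | rewrite /weights /=; lra].
Qed.
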